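(* Let $K(t,U)=\phi(t)\vartheta(U)$ for $t\in[0,T]$, $U\ge 0$, where $\vartheta:(0,\infty)\to(0,\infty)$ is a continuous and increasing function with $\vartheta(0^+)=0$ and $\phi$ is an integrable and nonnegative function on $[0,T]$, and suppose that $$\|F(t,u)-F(t,v)\|_{\mathcal{X}}\le K\big(t,\|u-v\|_{\mathcal{X}}\big)$$ for a.e. $t\in(0,T)$ and all $u,v\in\mathcal{X}$. Let $u_0,\hat u_0\in\mathcal{X}$ and let $u,\hat u\in C([0,T];\mathcal{X})$ be fixed points of $\mathcal{G}^{u_0}$ and $\mathcal{G}^{\hat u_0}$, respectively. Then $$\int_{\|u_0-\hat u_0\|_{\mathcal{X}}}^{\|u-\hat u\|_{\mathbb{B}_t}}\frac{ds}{\vartheta(s)}\le\int_0^t\phi(s)\,ds,\quad 0\le t\le T,$$ provided $\|u_0-\hat u_0\|_{\mathcal{X}}>0$. Moreover, under the Osgood condition $$\int_{0^+}\frac{dU}{\vartheta(U)}=\infty$$ one has the property $$\|u_0-\hat u_0\|_{\mathcal{X}}=0\ \Rightarrow\ \|u-\hat u\|_{\mathbb{B}_t}=0.$$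
   Context: $\mathcal{X}$ is a Banach space, $0<T<\infty$, and $\mathcal{A}$ is an m-accretive (possibly multivalued) operator on $\mathcal{X}$ with $\overline{\mathrm{D}(\mathcal{A})}=\mathcal{X}$, i.e. $\|(x-\hat x)+\lambda(y-\hat y)\|\ge\|x-\hat x\|$ for all $y\in\mathcal{A}x$, $\hat y\in\mathcal{A}\hat x$, $\lambda\ge 0$, and the range of $I+\mathcal{A}$ is $\mathcal{X}$. $\{S(t)\}_{t\ge 0}$ is the contraction semigroup on $\mathcal{X}$ generated by $\mathcal{A}$: $S(t)x=\lim_{n\to\infty}(I+\frac tn\mathcal{A})^{-n}x$. $F:[0,T]\times\mathcal{X}\to\mathcal{X}$ is such that the Bochner integral $\int_0^T F(s,u)\,ds$ makes sense in $\mathcal{X}$. For $w_0\in\mathcal{X}$, $$\mathcal{G}^{w_0}w(t)=S(t)w_0+\int_0^t S(t-s)F\big(s,w(s)\big)\,ds,\quad 0\le t<T.$$ For $t\in[0,T]$, $\mathbb{B}_t=C([0,t];\mathcal{X})$ with norm $\|w\|_{\mathbb{B}_t}=\sup_{0\le s\le t}\|w(s)\|_{\mathcal{X}}$. The function $\vartheta$ is extended by $\vartheta(0)=0$. *)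

(* Defs.v *)
From HB Require Import structures.
From mathcomp Require Import all_boot all_order all_algebra.
From mathcomp Require Import all_classical all_reals all_analysis.
Set Implicit Arguments.
Unset Strict Implicit.
Unset Printing Implicit Defensive.
Import Order.TTheory GRing.Theory Num.Theory.
Import numFieldNormedType.Exports.
Local Open Scope classical_set_scope.
Local Open Scope ring_scope.

(* Lebesgue measure on the sigma-algebra of all Lebesgue-measurable sets, so
   that "integrable" is not restricted to Borel functions. *)
Notation leb R := (@completed_lebesgue_measure R).

Section bochner.
Context {d : measure_display} {T : measurableType d} {R : realType}
  {X : completeNormedModType R}.
Variable mu : {measure set T -> \bar R}.
Implicit Types (D : set T) (f s : T -> X).

Definition integrable_simple D s :=
  [/\ finite_set (s @` D),
      forall x, measurable (D `&` s @^-1` [set x]) &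
      forall x, x != 0 -> (mu (D `&` s @^-1` [set x]) < +oo)%E].

(* [fine] may only truncate the measure of the level set of 0, which
   contributes nothing. *)
Definition simple_integral D s : X :=
  \sum_(x \in s @` D) fine (mu (D `&` s @^-1` [set x])) *: x.

(* The second clause is strong measurability. To be used with a complete mu:
   then `|f - g n| is measurable and the integral in the last clause is a
   genuine Lebesgue integral. *)
Definition bochner_approx D f (g : nat -> T -> X) :=
  [/\ forall n, integrable_simple D (g n),
      {ae mu, forall t, D t -> g n t @[n --> \oo] --> f t} &
      (\int[mu]_(t in D) (`|f t - g n t|)%:E)%E @[n --> \oo] --> 0%E].

Definition bochner_integrable D f := exists g, bochner_approx D f g.

(* The limit exists and does not depend on the approximating sequence; the
   value is 0 when f is not Bochner integrable. *)
Definition bochner_integral D f : X :=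
  xget 0 [set v | exists2 g, bochner_approx D f g &
                  simple_integral D (g n) @[n --> \oo] --> v].

End bochner.

Section accretive.
Context {R : realType} {X : completeNormedModType R}.
(* A multivalued operator: [A x y] means that y belongs to A x. *)
Implicit Types (A : X -> set X) (S : R -> X -> X).

Definition op_domain A : set X := [set x | A x !=set0].

Definition accretive A := forall (x x' y y' : X) (l : R),
  A x y -> A x' y' -> 0 <= l -> `|x - x'| <= `|(x - x') + l *: (y - y')|.

Definition m_accretive A :=
  accretive A /\ forall z, exists x, exists2 y, A x y & z = x + y.

(* (I + l A)^-1, which is single-valued and everywhere defined for A
   m-accretive and l > 0. *)
Definition resolvent A (l : R) (z : X) : X :=
  xget 0 [set x | exists2 y, A x y & z = x + l *: y].

(* Exponential formula. S(0) is the identity: the formula itself would give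
   the identity on the domain of A only. The term n = 0 of the sequence is
   irrelevant. *)
Definition generated_semigroup A S := forall x,
  S 0 x = x /\
  forall t, 0 < t -> iter n (resolvent A (t / n%:R)) x @[n --> \oo] --> S t x.

End accretive.

Section mild.
Context {R : realType} {X : completeNormedModType R}.
Variables (S : R -> X -> X) (F : R -> X -> X).
Implicit Types (w : R -> X) (t T : R).

Definition mild_integrand w t (s : R) : X := S (t - s) (F s (w s)).

Definition mild_map (w0 : X) w t : X :=
  S t w0 + bochner_integral (leb R) `[0, t] (mild_integrand w t).

Definition mild_fixed_point T (w0 : X) w :=
  {within `[0, T], continuous w} /\
  forall t, 0 <= t < T ->
    bochner_integrable (leb R) `[0, t] (mild_integrand w t) /\
    w t = mild_map w0 w t.

End mild.

(* Norm of C([0, t]; X). *)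
Definition sup_norm {R : realType} {X : completeNormedModType R} (t : R)
  (w : R -> X) : R := sup [set `|w s| | s in `[0, t]].

(* Divergence at 0+ : since theta is positive and continuous on (0, oo), the
   choice of the upper bound does not matter. *)
Definition osgood {R : realType} (theta : R -> R) :=
  \forall e \near 0^'+,
    (\int[leb R]_(U in `]0%R, e]) ((theta U)^-1)%:E = +oo)%E.

(* Main.v *)
Require Import Defs.
From HB Require Import structures.
From mathcomp Require Import all_boot all_order all_algebra.
From mathcomp Require Import finmap.
From mathcomp Require Import all_classical all_reals all_analysis.
From mathcomp Require Import measurable_realfun.
From mathcomp Require Import lra.

(** The difference [v t = `|u t - u' t|] of two mild solutions obeys a scalar
    integral inequality, and Osgood's separation of variables concludes.

    The first step uses that every [S t] is nonexpansive
    ([semigroup_nonexpansive]): the resolvents of an accretive operator are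
    nonexpansive, they are everywhere defined as soon as the range condition
    holds for one positive parameter ([m_accretive_full_range]), and the
    exponential formula preserves the estimate in the limit. Subtracting the
    two fixed-point equations and bounding the norm of a difference of Bochner
    integrals by a scalar integral ([bochner_integral_dist]) yields
    [v t <= a + \int_0^t phi (theta \o v)] for [a = `|u0 - u0'|]
    ([mild_dist_le]).

    The second step is the inequality of Bihari and LaSalle
    ([bihari_inequality]). Let [V t] be the right-hand side above, so that
    [v <= V]. Since [V] is nondecreasing,
    [V s - V r <= theta (V s) * (Phi s - Phi r)] with [Phi] the primitive of
    [phi], whereas [\int_(V r)^(V s) 1 / theta <= (V s - V r) / theta (V r)].
    As [theta \o V] is continuous, the ratio [theta (V s) / theta (V r)] is
    close to 1 when [r] and [s] are close, so the integral of [1 / theta] from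
    [V 0] to [V t] is at most [(1 + eta) * Phi t] for every [eta > 0]. Working
    with increments avoids differentiating the absolutely continuous function
    [V].

    The estimate also holds for every [a >= `|u0 - u0'|]. If the initial data
    coincide, each [a > 0] is allowed, and a positive sup norm would bound the
    integral of [1 / theta] over [a, e] uniformly in [a], against the Osgood
    condition ([osgood_uniqueness]). *)

Set Implicit Arguments.
Unset Strict Implicit.
Unset Printing Implicit Defensive.
Import Order.TTheory GRing.Theory Num.Theory.
Import numFieldNormedType.Exports.
Local Open Scope classical_set_scope.
Local Open Scope ring_scope.

(** * Accretive operators and their semigroups *)

Section semigroup.
Context {R : realType} {X : completeNormedModType R}.
Implicit Types (A : X -> set X) (S : R -> X -> X).

Lemma nonexpansive_fixed_point (J : X -> X) (c : R) (b : X) :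
  (forall x y, `|J x - J y| <= `|x - y|) -> `|c| < 1 ->
  exists x, x = J (b + c *: x).
Proof.
move=> J_ne c1; pose h (x : X) := J (b + c *: x).
have hU : {homo h : x / setT x >-> setT x} by [].
pose hF := HB.pack_for {fun setT >-> setT} h (isFun.Build _ _ setT setT h hU).
have hc : is_contraction hF.
  exists (NngNum (normr_ge0 c)); split => //= -[x y] /= _.
  apply: le_trans (J_ne _ _) _.
  by rewrite opprD addrACA subrr add0r -scalerBr normrZ.
have [x _ xE] := banach_fixed_point hc (@closedT X) (ex_intro _ 0 I).
by exists x.
Qed.

Definition full_range A (l : R) :=
  forall z, exists x, exists2 y, A x y & z = x + l *: y.

Lemma resolventP A l z : full_range A l ->
  exists2 y, A (resolvent A l z) y & z = resolvent A l z + l *: y.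
Proof. by move=> /(_ z) Az; exact: (xgetPex 0 Az). Qed.

Lemma resolvent_nonexpansive A l z z' : accretive A -> full_range A l ->
  0 <= l -> `|resolvent A l z - resolvent A l z'| <= `|z - z'|.
Proof.
move=> acc fr l0; have [y Ay zE] := resolventP z fr.
have [y' Ay' zE'] := resolventP z' fr.
rewrite [in leRHS]zE [in leRHS]zE' opprD addrACA -scalerBr; exact: acc.
Qed.

(** Solving [z \in x + l' A x] amounts to finding a fixed point of
    [x |-> J_l ((l / l') z + (1 - l / l') x)], where [J_l] is the resolvent of
    parameter [l]; this map is a contraction when [`|1 - l / l'| < 1], that is,
    when [l < 2 l']. *)
Lemma full_range_step A l l' : accretive A -> 0 < l -> l < 2 * l' ->
  full_range A l -> full_range A l'.
Proof.
move=> acc l0 ll' fr z; have l'0 : 0 < l' by lra.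
have c1 : `|1 - l / l'| < 1.
  have : 0 < l / l' by rewrite divr_gt0.
  have : l / l' < 2 by rewrite ltr_pdivrMr.
  by rewrite ltr_norml; lra.
have [x xE] := nonexpansive_fixed_point ((l / l') *: z)
  (fun u v => resolvent_nonexpansive u v acc fr (ltW l0)) c1.
have [y Ay] := resolventP ((l / l') *: z + (1 - l / l') *: x) fr.
rewrite -xE => yE; rewrite -xE in Ay; exists x; exists y => //.
have {}yE : (l / l') *: (z - x) = (l / l') *: (l' *: y).
  rewrite scalerA divfK ?gt_eqF// scalerBr; apply: (addrI x).
  by rewrite -yE scalerBl scale1r addrCA [x - _]addrC; congr (_ + _);
    rewrite addrC subrK.
have /scalerI : l / l' != 0 by rewrite mulf_neq0// ?invr_eq0 gt_eqF.
by move=> /(_ _ _ _ yE) <-; rewrite addrC subrK.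
Qed.

(** A single step from [l] reaches every parameter above [l / 2]. Starting from
    1, iterating with the factor 2 / 3 brings the parameter arbitrarily close to
    0, and a last step then reaches any prescribed [l]. *)
Lemma m_accretive_full_range A l : m_accretive A -> 0 < l -> full_range A l.
Proof.
move=> [acc rng1] l0.
have rngX n : full_range A ((2 / 3) ^+ n).
  elim: n => [|n IHn].
    by move=> z; have [x [y Ay ->]] := rng1 z; exists x; exists y;
      rewrite // expr0 scale1r.
  have : 0 < (2 / 3 : R) ^+ n by rewrite exprn_gt0.
  move=> Xn0; apply: full_range_step IHn => //; rewrite exprS; lra.
have : (2 / 3 : R) ^+ n @[n --> \oo] --> 0.
  by apply: cvg_expr; rewrite ger0_norm; lra.
move=> /cvgrPdist_lt /(_ l l0) [n _ /(_ n (leqnn _))] /=.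
have Xn0 : 0 < (2 / 3 : R) ^+ n by rewrite exprn_gt0.
rewrite sub0r normrN ger0_norm ?ltW// => Xnl.
by apply: full_range_step (rngX n) => //; lra.
Qed.

Lemma semigroup_nonexpansive A S (t : R) x x' : m_accretive A ->
  generated_semigroup A S -> 0 <= t -> `|S t x - S t x'| <= `|x - x'|.
Proof.
move=> Am Sg; rewrite le_eqVlt => /predU1P[<-|t0].
  by rewrite (Sg x).1 (Sg x').1.
have cvS := cvg_norm (cvgB ((Sg x).2 t t0) ((Sg x').2 t t0)).
apply: (ler_cvg_to (cvS _ _) (cvg_cst _)); near=> n.
have n0 : (0 < n)%N by near: n; exists 1%N.
have tn0 : 0 < t / n%:R by rewrite divr_gt0 // ltr0n.
suff ne m : `|iter m (resolvent A (t / n%:R)) x -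
    iter m (resolvent A (t / n%:R)) x'| <= `|x - x'| by exact: ne.
elim: m => //= m IHm; apply: le_trans IHm.
apply: resolvent_nonexpansive; [exact: Am.1| |exact: ltW].
exact: m_accretive_full_range.
Unshelve. all: by end_near. Qed.

End semigroup.

(** * Differences of Bochner integrals *)

Section bochner.
Context {d : measure_display} {T : measurableType d} {R : realType}
  {X : completeNormedModType R}.
Variable mu : {measure set T -> \bar R}.

Section level_sets.
Context {Y : choiceType} (D : set T) (p : T -> Y).
Hypothesis p_fin : finite_set (p @` D).
Hypothesis mp : forall y, measurable (D `&` p @^-1` [set y]).
Let level y := D `&` p @^-1` [set y].
Let r : seq Y := fset_set (p @` D).

Let mem_r t : D t -> p t \in r.
Proof. by move=> Dt; rewrite /r in_fset_set//; apply: mem_set; exists t. Qed.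

Let trivIset_level (A : set Y) : trivIset A level.
Proof. by move=> y z _ _ [t [[_ <-] [_ <-]]]. Qed.

(** All the facts below about a simple function [p] follow from this finite
    decomposition into level sets. The codomain of [p] is an arbitrary
    [choiceType], so that a pair of simple functions is again an instance. *)
Lemma preimage_level (B : set Y) :
  D `&` p @^-1` B = \big[setU/set0]_(y <- r | y \in B) level y.
Proof.
rewrite -bigcup_seq_cond; apply/seteqP; split=> [t [Dt Bt]|t []].
  by exists (p t); first by apply/andP; split; [exact: mem_r|exact/mem_set].
move=> y /= /andP[_ By] [Dt pt].
by split; rewrite //= pt; exact: set_mem.
Qed.

Lemma simple_measurable_preimage (B : set Y) : measurable (D `&` p @^-1` B).
Proof.
by rewrite preimage_level; apply: bigsetU_measurable => y _; exact: mp.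
Qed.

Lemma simple_measurable_fun d' (Z : measurableType d') (k : Y -> Z) :
  measurable_fun D (k \o p).
Proof. by move=> _ B _; exact: (simple_measurable_preimage (k @^-1` B)). Qed.

Lemma integral_simple (k : Y -> \bar R) : (forall y, 0 <= k y)%E ->
  (\int[mu]_(t in D) k (p t) = \sum_(y <- r) k y * mu (level y))%E.
Proof.
move=> k0; have DE : D = \big[setU/set0]_(y <- r) level y.
  rewrite -[LHS]setIT -[setT](preimage_setT p) preimage_level.
  by apply: eq_bigl => y; rewrite in_setT.
rewrite {1}DE ge0_integral_bigsetU//=; last first.
- by rewrite -DE => _ B _; exact: (simple_measurable_preimage (k @^-1` B)).
- by rewrite /r; exact: fset_uniq.
apply: eq_bigr => y _; rewrite -(integral_cst mu (mp y)).
by apply: eq_integral => t; rewrite inE => -[_ <-].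
Qed.

(** The definition of [simple_integral] sums over the values of [h \o p];
    refining to the level sets of [p] allows two integrals with different values
    to be compared term by term. The level set of 0 may have infinite measure,
    which is harmless because its terms vanish on both sides. *)
Lemma simple_integral_comp (h : Y -> X) :
  (forall x, x != 0 -> (mu (D `&` (h \o p) @^-1` [set x]) < +oo)%E) ->
  simple_integral mu D (h \o p) = \sum_(y <- r) fine (mu (level y)) *: h y.
Proof.
move=> h_fin; have hp_fin : finite_set ((h \o p) @` D).
  by rewrite -image_comp; exact: finite_image.
rewrite /simple_integral fsbig_finite//=.
under eq_bigr => x _.
  rewrite (_ : _ *: x = \sum_(y <- r | h y == x) fine (mu (level y)) *: x).
    over.
  have [->|x0] := eqVneq x 0.
    by rewrite scaler0 big1// => y; rewrite scaler0.
  rewrite -scaler_suml; congr (_ *: _).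
  have E : D `&` (h \o p) @^-1` [set x] =
      \big[setU/set0]_(y <- r | h y == x) level y.
    rewrite (preimage_level (h @^-1` [set x])); apply: eq_bigl => y.
    by apply/idP/eqP; rewrite inE.
  have := h_fin x x0; rewrite E => fin.
  have sub y : y \in r -> h y == x -> (mu (level y) < +oo)%E.
    move=> yr hy; apply: le_lt_trans fin; apply: le_measure; rewrite ?inE//.
    - exact: mp.
    - by apply: bigsetU_measurable => z _; exact: mp.
    - by rewrite -bigcup_seq_cond; apply: bigcup_sup => /=; rewrite yr.
  have mE : mu (\big[setU/set0]_(y <- r | h y == x) level y) =
      (\sum_(y <- r | h y == x) mu (level y))%E.
    rewrite -big_filter fsbig_seq ?filter_uniq ?fset_uniq// measure_fsbig//.
    - by rewrite -fsbig_seq ?filter_uniq ?fset_uniq// big_filter.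
    - by move=> y _; exact: mp.
  rewrite mE big_seq_cond [RHS]big_seq_cond sum_fine// => y /andP[yr hy].
  by rewrite ge0_fin_numE// sub.
rewrite (exchange_big_dep predT)//=; apply: eq_big_seq => y yr.
have hyr : h y \in fset_set ((h \o p) @` D).
  move: yr; rewrite !in_fset_set// => /set_mem[t Dt <-].
  by apply/mem_set; exists t.
rewrite big_mkcond (bigD1_seq _ hyr) ?fset_uniq//= eqxx big1 ?addr0// => x.
by rewrite eq_sym => /negbTE ->.
Qed.

End level_sets.

Section pair.
Variables (D : set T) (s s' : T -> X).
Hypotheses (s_simple : integrable_simple mu D s)
  (s'_simple : integrable_simple mu D s').
Let p t := (s t, s' t).

Let p_fin : finite_set (p @` D).
Proof.
case: s_simple s'_simple => fs _ _ [fs' _ _].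
apply: sub_finite_set (finite_setX fs fs') => _ [t Dt <-].
by split; exists t.
Qed.

Let mp y : measurable (D `&` p @^-1` [set y]).
Proof.
case: s_simple s'_simple => _ ms _ [_ ms' _].
rewrite (_ : _ `&` _ =
    (D `&` s @^-1` [set y.1]) `&` (D `&` s' @^-1` [set y.2])).
  exact: measurableI.
apply/seteqP; case: y => x x'.
by split => [t [Dt [<- <-]]//|t [[Dt /= <-] [_ <-]]].
Qed.

Lemma measurable_simple_dist : measurable_fun D (fun t => `|s t - s' t|).
Proof. exact: (simple_measurable_fun p_fin mp (fun y => `|y.1 - y.2|)). Qed.

(** On the common refinement given by the pair [p], this is the triangle
    inequality for a finite sum. *)
Lemma simple_integral_dist :
  (`|simple_integral mu D s - simple_integral mu D s'|%:E <=
   \int[mu]_(t in D) (`|s t - s' t|)%:E)%E.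
Proof.
have [_ _ s_lty] := s_simple; have [_ _ s'_lty] := s'_simple.
rewrite (simple_integral_comp p_fin mp (h := fst))//.
rewrite (simple_integral_comp p_fin mp (h := snd))//.
rewrite (integral_simple p_fin mp (k := fun y => (`|y.1 - y.2|)%:E))//.
rewrite -sumrB; apply: le_trans (_ : _ <= \sum_(y <- fset_set (p @` D))
    (`|fine (mu (D `&` p @^-1` [set y])) *: y.1 -
       fine (mu (D `&` p @^-1` [set y])) *: y.2|)%:E)%E _.
  by rewrite sumEFin lee_fin; exact: ler_norm_sum.
apply: lee_sum => y _.
(* [fine] can only decrease the measure of a level set. *)
rewrite -scalerBr normrZ ger0_norm ?fine_ge0// mulrC EFinM lee_wpmul2l//.
have [->|fin] := eqVneq (mu (D `&` p @^-1` [set y])) +oo%E.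
  by rewrite leey.
by rewrite fineK// ge0_fin_numE// ltey.
Qed.

End pair.

Section limits.
Hypothesis cmu : measure_is_complete mu.
Variables (D : set T).
Hypothesis mD : measurable D.

(** The function is almost everywhere the limit of the measurable functions
    [`|g m - g n|]; completeness of [mu] turns this into measurability. *)
Lemma measurable_approx_dist (f : T -> X) (g : nat -> T -> X) n :
  bochner_approx mu D f g ->
  measurable_fun D ((fun t => (`|f t - g n t|)%:E) : T -> \bar R).
Proof.
move=> [g_simple g_cvg _].
pose k t := limn_esup (fun m => (`|g m t - g n t|)%:E).
apply: (ae_measurable_fun cmu (f := k)).
  apply: filterS g_cvg => t gf /gf {}gf.
  have : (`|g m t - g n t|)%:E @[m --> \oo] --> (`|f t - g n t|)%:E.
    apply: cvg_EFin; first by near=> m.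
    by apply: cvg_norm; apply: cvgB => //; exact: cvg_cst.
  by move=> /cvg_limn_einf_sup[_ <-].
apply: measurable_fun_limn_esup => m; apply/measurable_EFinP.
exact: measurable_simple_dist.
Unshelve. all: by end_near. Qed.

(** Taken with [g = f] and [h = 0], this estimate gives the Cauchy criterion for
    the integrals of an approximating sequence; letting [n] and [m] tend to
    infinity, it gives the bound on a difference of Bochner integrals. *)
Lemma simple_integral_approx_dist (f g : T -> X) (f_ g_ : nat -> T -> X)
    (h : T -> \bar R) n m :
  bochner_approx mu D f f_ -> bochner_approx mu D g g_ ->
  measurable_fun D h -> (forall t, D t -> 0 <= h t)%E ->
  {ae mu, forall t, D t -> ((`|f t - g t|)%:E <= h t)%E} ->
  (`|simple_integral mu D (f_ n) - simple_integral mu D (g_ m)|%:E <=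
   \int[mu]_(t in D) h t +
   (\int[mu]_(t in D) (`|f t - f_ n t|)%:E +
    \int[mu]_(t in D) (`|g t - g_ m t|)%:E))%E.
Proof.
move=> af ag mh h0 fgh; have [f_s _ _] := af; have [g_s _ _] := ag.
have mf := measurable_approx_dist n af; have mg := measurable_approx_dist m ag.
apply: le_trans (simple_integral_dist (f_s n) (g_s m)) _.
rewrite -ge0_integralD// -ge0_integralD//; first last.
- exact: emeasurable_funD.
- by move=> t _; rewrite adde_ge0.
apply: ae_ge0_le_integral => //.
- by apply/measurable_EFinP; exact: measurable_simple_dist.
- by move=> t Dt; rewrite !adde_ge0// h0.
- by do 2! apply: emeasurable_funD => //.
apply: filterS fgh => t fgh /fgh {}fgh.
rewrite (le_trans _ (leeD2r _ fgh))// -!EFinD lee_fin.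
rewrite -[f_ n t - g_ m t](subrKA (g t)) -[f_ n t - g t](subrKA (f t)).
apply: le_trans (ler_normD _ _) _; rewrite [leRHS]addrA lerD2r.
by apply: le_trans (ler_normD _ _) _; rewrite distrC addrC.
Qed.

Lemma simple_integral_cvg (f : T -> X) (g : nat -> T -> X) :
  bochner_approx mu D f g -> cvgn (fun n => simple_integral mu D (g n)).
Proof.
move=> fg; have [_ _ /= g_cvg] := fg.
apply/cauchy_cvgP/cauchy_exP => e e0.
have e20 : (0 < (e / 2)%:E)%E by rewrite lte_fin divr_gt0.
have [N _ gN] := g_cvg _ (open_ereal_lt' e20).
exists (simple_integral mu D (g N)); exists N => //= n Nn.
rewrite /preimage /= -ball_normE /= -lte_fin.
apply: le_lt_trans
  (simple_integral_approx_dist (h := cst 0%E) _ _ fg fg _ _ _) _ => //.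
- by apply: aeW => t _; rewrite subrr normr0.
- rewrite integral0 add0e [e]splitr EFinD; apply: lteD; apply: gN => //=.
Qed.

Lemma bochner_integral_dist (f g : T -> X) (h : T -> \bar R) :
  bochner_integrable mu D f -> bochner_integrable mu D g ->
  measurable_fun D h -> (forall t, D t -> 0 <= h t)%E ->
  {ae mu, forall t, D t -> ((`|f t - g t|)%:E <= h t)%E} ->
  ((`|bochner_integral mu D f - bochner_integral mu D g|)%:E <=
   \int[mu]_(t in D) h t)%E.
Proof.
have value (k : T -> X) : bochner_integrable mu D k ->
    exists2 k_, bochner_approx mu D k k_ &
      simple_integral mu D (k_ n) @[n --> \oo] --> bochner_integral mu D k.
  move=> [k_ ak].
  apply: (xgetPex 0 (P := [set v | exists2 g, bochner_approx mu D k g &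
    simple_integral mu D (g n) @[n --> \oo] --> v])).
  by have /cvg_ex[v kv] := simple_integral_cvg ak; exists v; exists k_.
move=> /value[f_ af f_cvg] /value[g_ ag g_cvg] mh h0 fgh.
have [[_ _ f_0] [_ _ g_0]] := (af, ag).
have lhs : (`|simple_integral mu D (f_ n) - simple_integral mu D (g_ n)|)%:E
    @[n --> \oo] --> (`|bochner_integral mu D f - bochner_integral mu D g|)%:E.
  apply: cvg_EFin; first by near=> n.
  by apply: cvg_norm; apply: cvgB.
have rhs : (\int[mu]_(t in D) h t + (\int[mu]_(t in D) (`|f t - f_ n t|)%:E +
    \int[mu]_(t in D) (`|g t - g_ n t|)%:E) @[n --> \oo] -->
    \int[mu]_(t in D) h t + (0 + 0))%E.
  apply: cvgeD; [by rewrite adde0 fin_num_adde_defl| exact: cvg_cst|].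
  exact: cvgeD.
rewrite -[leRHS]adde0 -[X in (_ + X)%E]adde0.
apply: (lee_cvg_to lhs rhs); near=> n.
exact: simple_integral_approx_dist.
Unshelve. all: by end_near. Qed.

End limits.
End bochner.

(** * The completed Lebesgue measure on intervals *)

Section lebesgue.
Context {R : realType}.

(** A copy of [R] used in type annotations: it selects the completed
    sigma-algebra, where [R] itself would select the Borel one. *)
Definition lebesgueType : measurableType _ :=
  caratheodory_type (wlength (@idfun R))^*%mu.

Lemma leb_measurable (D : set R) :
  measurable D -> measurable (D : set lebesgueType).
Proof. exact: sub_caratheodory. Qed.

Lemma leb_measurable_fun (D : set R) (f : R -> R) : measurable D ->
  measurable_fun D f ->
  measurable_fun (D : set lebesgueType) (f : lebesgueType -> R).
Proof. by move=> mD mf _ B mB; apply: leb_measurable; exact: mf. Qed.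

Lemma leb_measurable_itv (i : interval R) :
  measurable ([set` i] : set lebesgueType).
Proof. by apply: leb_measurable; exact: measurable_itv. Qed.

Lemma leb_itv (a b : R) (x y : bool) : a <= b ->
  leb R [set` Interval (BSide x a) (BSide y b)] = (b - a)%:E.
Proof.
move=> ab; have := lebesgue_measure_itv (Interval (BSide x a) (BSide y b)).
rewrite /= lte_fin; move: ab; rewrite le_eqVlt => /predU1P[->|->].
  by rewrite ltxx subrr.
by rewrite EFinB.
Qed.

Lemma leb_set1 (a : R) : leb R [set a] = 0%E.
Proof. exact: lebesgue_measure_set1. Qed.

Lemma Rintegral_leb_itv1 (a : R) (f : R -> R) :
  \int[leb R]_(x in `[a, a]) f x = 0.
Proof.
rewrite /Rintegral set_itv1 (eq_integral (cst (f a)%:E)); last first.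
  by move=> x; rewrite inE => ->.
rewrite integral_cst; last by apply: leb_measurable; exact: measurable_set1.
by rewrite [X in (_ * X)%E]leb_set1 mule0.
Qed.

Lemma integrable_sub_itv (T a b : R) (x y : bool) (f : R -> \bar R) :
  0 <= a -> b <= T -> (leb R).-integrable `[0, T] f ->
  (leb R).-integrable [set` Interval (BSide x a) (BSide y b)] f.
Proof.
move=> a0 bT; apply: integrableS; try exact: leb_measurable_itv.
move=> s /=; rewrite !in_itv/= => /andP[].
move=> /lteifW as_ /lteifW sb.
by rewrite (le_trans a0)// (le_trans sb).
Qed.

Lemma Rintegral_leb_itvD (T r s : R) (f : R -> R) :
  0 <= r -> r <= s -> s <= T -> (leb R).-integrable `[0, T] (EFin \o f) ->
  \int[leb R]_(x in `[0, s]) f x =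
  \int[leb R]_(x in `[0, r]) f x + \int[leb R]_(x in `]r, s]) f x.
Proof.
move=> r0 rs sT fi.
have E : `[0, s]%classic = `[0, r] `|` `]r, s] :> set R.
  by apply: itv_bndbnd_setU; rewrite bnd_simp.
rewrite E Rintegral_setU//; try exact: leb_measurable_itv.
  by rewrite -E; exact: integrable_sub_itv fi.
apply/disj_setPS => x /=; rewrite !in_itv/= => -[/andP[_ xr] /andP[rx _]].
by move: (le_lt_trans xr rx); rewrite ltxx.
Qed.

Lemma Rintegral_abs_continuous (T : R) (f : R -> R) (e : R) :
  (leb R).-integrable `[0, T] (EFin \o f) ->
  (forall x : R, 0 <= x <= T -> 0 <= f x) ->
  0 < e -> exists2 d : R, 0 < d & forall r s : R, 0 <= r -> r <= s -> s <= T ->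
    s - r < d -> \int[leb R]_(x in `]r, s]) f x < e.
Proof.
move=> fi f0 e0.
have fi' : (leb R).-integrable setT (EFin \o (f \_ `[0, T])).
  rewrite -restrict_EFin; apply: (iffLR (integrable_mkcond _ _) fi).
  exact: leb_measurable_itv.
have [d [d0 fd]] := integral_normr_continuous fi' e0.
exists d => // r s r0 rs sT rsd.
apply: le_lt_trans (fd `]r, s]%classic (leb_measurable_itv _) _); last first.
  by rewrite [ltLHS](leb_itv false false rs) lte_fin.
rewrite le_eqVlt; apply/orP; left; apply/eqP/eq_Rintegral => x.
rewrite inE/= in_itv/= => /andP[rx xs].
have x0T : 0 <= x <= T by rewrite (le_trans r0 (ltW rx)) (le_trans xs sT).
rewrite patchE ifT; last by rewrite inE/= in_itv.
by rewrite ger0_norm// f0.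
Qed.

End lebesgue.

(** * Separation of variables *)

Section osgood.
Context {R : realType}.
Variable theta : R -> R.
Hypothesis theta_gt0 : forall U : R, 0 < U -> 0 < theta U.
Hypothesis theta_incr : forall U V : R, 0 < U -> U <= V -> theta U <= theta V.

Local Notation W x y := (\int[leb R]_(U in `[x, y]) ((theta U)^-1)%:E)%E.

(** Truncating the argument below at [a > 0] makes [1 / theta] nonincreasing on
    the whole line, hence Borel. *)
Lemma measurable_inv_modulus (a b : R) : 0 < a ->
  measurable_fun (`[a, b]%classic : set lebesgueType)
    (fun U : lebesgueType => ((theta U)^-1)%:E : \bar R).
Proof.
move=> a0; pose g U := (theta (Num.max a U))^-1.
have g_ni : nonincreasing_fun g.
  move=> x y xy; have maxP z : 0 < Num.max a z by rewrite lt_max a0.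
  rewrite /g lef_pV2 ?posrE ?theta_gt0//; apply: theta_incr => //.
  by rewrite ge_max !le_max lexx xy orbT.
have mab : measurable (`[a, b]%classic : set R) by exact: measurable_itv.
have mg := leb_measurable_fun mab (nonincreasing_measurable mab g_ni).
apply/measurable_EFinP; apply: eq_measurable_fun mg => U.
by rewrite inE/= in_itv/= => /andP[aU _]; rewrite /g max_r.
Qed.

Lemma inv_modulus_ge0 (a b U : R) : 0 < a -> `[a, b]%classic U ->
  (0 <= ((theta U)^-1)%:E)%E.
Proof.
move=> a0 /=; rewrite in_itv/= => /andP[aU _].
by rewrite lee_fin invr_ge0 ltW// theta_gt0// (lt_le_trans a0).
Qed.

Lemma osgood_integral_le (x y : R) : 0 < x -> x <= y ->
  (W x y <= ((y - x) / theta x)%:E)%E.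
Proof.
move=> x0 xy.
have := integral_cst (leb R) (leb_measurable_itv `[x, y]) ((theta x)^-1)%:E.
rewrite [X in (_ * X)%E](leb_itv true false xy) -EFinM mulrC => <-.
apply: ge0_le_integral.
- exact: leb_measurable_itv.
- by move=> U; exact: inv_modulus_ge0.
- exact: measurable_inv_modulus.
- exact: measurable_cst.
- move=> U /=; rewrite in_itv/= => /andP[xU _].
  by rewrite lee_fin lef_pV2 ?posrE ?theta_gt0 ?(lt_le_trans x0)// theta_incr.
Qed.

Lemma osgood_integral_chain (a x y : R) : 0 < a -> a <= x -> x <= y ->
  (W a y <= W a x + W x y)%E.
Proof.
move=> a0 ax xy.
have E : `[a, y]%classic = `[a, x] `|` `]x, y] :> set R.
  by apply: itv_bndbnd_setU; rewrite bnd_simp.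
rewrite E ge0_integral_setU; first last.
- apply/disj_setPS => z /=; rewrite !in_itv/= => -[/andP[_ zx] /andP[xz _]].
  by move: (le_lt_trans zx xz); rewrite ltxx.
- by rewrite -E => U; exact: inv_modulus_ge0.
- by rewrite -E; exact: measurable_inv_modulus.
- exact: leb_measurable_itv.
- exact: leb_measurable_itv.
apply: leeD2l; apply: ge0_subset_integral; try exact: leb_measurable_itv.
- by apply: measurable_inv_modulus; exact: lt_le_trans ax.
- by move=> U; apply: inv_modulus_ge0; exact: lt_le_trans ax.
- by move=> U /=; rewrite !in_itv/= => /andP[/ltW -> ->].
Qed.

Lemma osgood_integral_mono (a x y : R) : 0 < a -> x <= y -> (W a x <= W a y)%E.
Proof.
move=> a0 xy; apply: ge0_subset_integral; try exact: leb_measurable_itv.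
- exact: measurable_inv_modulus.
- by move=> U; exact: inv_modulus_ge0.
- by move=> U /=; rewrite !in_itv/= => /andP[-> /le_trans]; exact.
Qed.

Lemma modulus_ratio (c eta : R) :
  {for c, continuous theta} -> 0 < c -> 0 < eta ->
  exists2 k : R, 0 < k & forall x y : R, `|x - c| < k -> `|y - c| < k ->
    theta y <= (1 + eta) * theta x.
Proof.
move=> tc c0 eta0; have tc0 := theta_gt0 c0.
(* This [e] solves [theta c + e = (1 + eta) * (theta c - e)]. *)
pose e := eta * theta c / (2 + eta).
have eE : e * (2 + eta) = eta * theta c by rewrite divfK// gt_eqF//; lra.
have e0 : 0 < e by rewrite divr_gt0 ?mulr_gt0//; lra.
move/cvgrPdist_lt : tc => /(_ e e0)[k /= k0 tk].
exists k => // x y xk yk.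
have /andP[x1 x2] : - e < theta c - theta x < e.
  by rewrite -ltr_norml; apply: tk; rewrite /= distrC.
have /andP[y1 y2] : - e < theta c - theta y < e.
  by rewrite -ltr_norml; apply: tk; rewrite /= distrC.
nra.
Qed.

Section comparison.
Variables (t : R) (V Phi : R -> R).
Hypothesis theta_cont : forall U : R, 0 < U -> {for U, continuous theta}.
Hypothesis t_ge0 : 0 <= t.
Hypothesis V0_gt0 : 0 < V 0.
Hypothesis Phi0 : Phi 0 = 0.
Hypothesis V_nd : forall r s : R, 0 <= r -> r <= s -> s <= t -> V r <= V s.
Hypothesis V_incr : forall r s : R, 0 <= r -> r <= s -> s <= t ->
  V s - V r <= theta (V s) * (Phi s - Phi r).
Hypothesis Phi_cont : forall e : R, 0 < e -> exists2 d : R, 0 < d &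
  forall r s : R, 0 <= r -> r <= s -> s <= t -> s - r < d -> Phi s - Phi r < e.

Let V_gt0 (r : R) : 0 <= r -> r <= t -> 0 < V r.
Proof. by move=> r0 rt; apply: lt_le_trans V0_gt0 _; exact: V_nd. Qed.

Let V_cont (e : R) : 0 < e -> exists2 d : R, 0 < d &
  forall r s : R, 0 <= r <= t -> 0 <= s <= t -> `|s - r| < d ->
  `|V s - V r| < e.
Proof.
move=> e0; have Vt0 := theta_gt0 (V_gt0 t_ge0 (lexx t)).
have [|d d0 Hd] := Phi_cont (e := e / theta (V t)); first by rewrite divr_gt0.
exists d => // r s; wlog rs : r s / r <= s.
  move=> wl rt st; have [/wl|/ltW/wl] := leP r s; first exact.
  by rewrite distrC (distrC (V s)); exact.
move=> /andP[r0 rt] /andP[s0 st].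
rewrite ger0_norm ?subr_ge0// => /(Hd _ _ r0 rs st) Pd.
rewrite ger0_norm ?subr_ge0 ?V_nd//.
apply: le_lt_trans (V_incr r0 rs st) _.
have th_s : theta (V s) <= theta (V t) by rewrite theta_incr// ?V_gt0 ?V_nd.
have th_s0 : 0 < theta (V s) by rewrite theta_gt0// V_gt0.
move: Pd; rewrite ltr_pdivlMr// => Pd.
have [P0|P0] := leP 0 (Phi s - Phi r); last by nra.
by apply: le_lt_trans Pd; rewrite mulrC ler_wpM2l.
Qed.

(** The local form of the comparison: near [c], the loss from evaluating
    [theta] at the upper end [V s] in one estimate and at the lower end [V r] in
    the other is a factor at most [1 + eta]. *)
Let step (eta c : R) : 0 < eta -> 0 <= c <= t -> exists2 d : R, 0 < d &
  forall r s : R, 0 <= r -> r <= s -> s <= t -> `|r - c| < d -> `|s - c| < d ->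
    (W (V r) (V s) <= ((1 + eta) * (Phi s - Phi r))%:E)%E.
Proof.
move=> eta0 ct; have /andP[c0 ct'] := ct.
have Vc0 := V_gt0 c0 ct'.
have [k k0 Hk] := modulus_ratio (theta_cont Vc0) Vc0 eta0.
have [d d0 Hd] := V_cont k0; exists d => // r s r0 rs st rd sd.
have rt := le_trans rs st; have s0 := le_trans r0 rs.
have Vr0 := V_gt0 r0 rt.
apply: le_trans (osgood_integral_le Vr0 (V_nd r0 rs st)) _.
rewrite lee_fin ler_pdivrMr ?theta_gt0//.
apply: le_trans (V_incr r0 rs st) _.
have rat : theta (V s) <= (1 + eta) * theta (V r).
  by apply: Hk; apply: Hd => //; rewrite ?r0 ?s0.
have := theta_gt0 Vr0; have := theta_gt0 (V_gt0 s0 st) => ths thr.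
have P0 : 0 <= Phi s - Phi r.
  have := V_incr r0 rs st; have := V_nd r0 rs st => h1 h2.
  by rewrite -(pmulr_rge0 _ ths); lra.
by rewrite mulrAC ler_wpM2r.
Qed.

(** Continuation: let [c] be the supremum of the times at which the estimate
    holds. From such a time just before [c], [step] carries the estimate beyond
    [c], or up to [t] if that comes first. *)
Let approx (eta : R) : 0 < eta -> (W (V 0) (V t) <= ((1 + eta) * Phi t)%:E)%E.
Proof.
move=> eta0.
pose E := [set s | 0 <= s <= t /\ (W (V 0) (V s) <= ((1 + eta) * Phi s)%:E)%E].
have E0 : E 0.
  split; first by rewrite lexx.
  apply: le_trans (osgood_integral_le V0_gt0 (lexx _)) _.
  by rewrite subrr mul0r Phi0 mulr0.
have Eub : ubound E t by move=> s [/andP[]].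
have Esup : has_sup E by split; [exists 0 | exists t].
have c0 : 0 <= sup E by apply: ub_le_sup => //; exists t.
have ct : sup E <= t by apply: sup_le_ub => //; exists 0.
have cI : 0 <= sup E <= t by rewrite c0.
have [d d0 Hd] := step eta0 cI.
have [r [/andP[r0 rt] Wr] dr] := sup_adherent d0 Esup.
have rc : r <= sup E by apply: ub_le_sup; [exists t | split => //; rewrite r0].
pose s := Num.min t (sup E + d / 2).
have cs : sup E <= s by rewrite /s le_min ct/=; lra.
have st : s <= t by rewrite /s ge_min lexx.
have sd : s <= sup E + d / 2 by rewrite /s ge_min lexx orbT.
have rs := le_trans rc cs.
have Es : E s.
  split; first by rewrite st andbT; lra.
  apply: le_trans (osgood_integral_chain V0_gt0 (V_nd (lexx 0) r0 rt)
    (V_nd r0 rs st)) _.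
  apply: le_trans (leeD Wr (Hd r s r0 rs st _ _)) _.
  - by rewrite ltr_norml; lra.
  - by rewrite ltr_norml; lra.
  by rewrite -EFinD lee_fin; lra.
have sc : s <= sup E by apply: ub_le_sup => //; exists t.
suff <- : s = t by case: Es.
rewrite /s; apply/min_idPl; rewrite leNgt; apply/negP => /ltW/min_r sE.
by move: sc; rewrite /s sE; lra.
Qed.

Lemma osgood_comparison : (W (V 0) (V t) <= (Phi t)%:E)%E.
Proof.
have Pt0 : 0 <= Phi t.
  have := V_incr (lexx 0) t_ge0 (lexx t); have := V_nd (lexx 0) t_ge0 (lexx t).
  rewrite Phi0 subr0 => h1 h2.
  by rewrite -(pmulr_rge0 _ (theta_gt0 (V_gt0 t_ge0 (lexx t)))); lra.
apply/lee_addgt0Pr => e e0.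
have eta0 : 0 < e / (Phi t + 1) by rewrite divr_gt0//; lra.
apply: le_trans (approx eta0) _; rewrite -EFinD lee_fin mulrDl mul1r lerD2l.
rewrite mulrAC ler_pdivrMr ?mulrDr ?mulr1 ?lerDl; [exact: ltW|lra].
Qed.

End comparison.
End osgood.

Section bihari.
Context {R : realType}.
Variables (theta phi v : R -> R) (T a : R).
Hypothesis theta_gt0 : forall U : R, 0 < U -> 0 < theta U.
Hypothesis theta_incr : forall U V : R, 0 < U -> U <= V -> theta U <= theta V.
Hypothesis theta_cont : forall U : R, 0 < U -> {for U, continuous theta}.
Hypothesis theta_0 : theta 0 = 0.
Hypothesis phi_int : (leb R).-integrable `[0, T] (EFin \o phi).
Hypothesis phi_ge0 : forall t : R, 0 <= t <= T -> 0 <= phi t.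
Hypothesis v_ge0 : forall t : R, 0 <= v t.
Hypothesis v_cont : {within `[0, T], continuous v}.

Let psi s := phi s * theta (v s).

Lemma modulus_ge0 (U : R) : 0 <= U -> 0 <= theta U.
Proof.
by rewrite le_eqVlt => /predU1P[<-|/theta_gt0/ltW//]; rewrite theta_0.
Qed.

Lemma modulus_mono (U V : R) : 0 <= U -> U <= V -> theta U <= theta V.
Proof.
rewrite le_eqVlt => /predU1P[<-|]; last exact: theta_incr.
by rewrite theta_0; exact: modulus_ge0.
Qed.

Lemma kernel_ge0 (t : R) : 0 <= t <= T -> 0 <= psi t.
Proof. by move=> tT; rewrite mulr_ge0 ?phi_ge0 ?modulus_ge0. Qed.

(** Extended by 0 to the negative numbers, [theta] is nondecreasing on the whole
    line, hence Borel. *)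
Lemma measurable_kernel :
  measurable_fun (`[0, T]%classic : set lebesgueType) (psi : lebesgueType -> R).
Proof.
pose th x := if x <= 0 then 0 else theta x.
have th_nd : nondecreasing_fun th.
  move=> x y xy; rewrite /th; case: (leP x 0) => x0; case: (leP y 0) => y0 //.
  - by rewrite ltW// theta_gt0.
  - by move: (lt_le_trans x0 (le_trans xy y0)); rewrite ltxx.
  - exact: theta_incr.
have thE : (fun s => th (v s)) = theta \o v.
  apply/funext => s /=; rewrite /th; case: leP => // vs0.
  by have /eqP -> : v s == 0; [rewrite eq_le vs0 v_ge0 | rewrite theta_0].
have mT : measurable (`[0, T]%classic : set R) by exact: measurable_itv.
apply: measurable_funM; first exact/measurable_EFinP/(measurable_int _ phi_int).
suff mtv : measurable_fun `[0, T] (theta \o v).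
  exact: leb_measurable_fun mT mtv.
rewrite -thE; apply: measurableT_comp; first exact: nondecreasing_measurable.
exact: subspace_continuous_measurable_fun.
Qed.

Lemma integrable_kernel : 0 <= T -> (leb R).-integrable `[0, T] (EFin \o psi).
Proof.
move=> T0; have [c cT v_max] := EVT_max T0 v_cont.
apply: (le_integrable (leb_measurable_itv _)
  (g := fun s => ((theta (v c))%:E * (phi s)%:E)%E)).
- exact/measurable_EFinP/measurable_kernel.
- move=> s sT; rewrite -EFinM lee_fin.
  have sT' : 0 <= s <= T by move: sT; rewrite /= in_itv.
  rewrite !ger0_norm ?mulr_ge0 ?phi_ge0 ?modulus_ge0//.
  by rewrite /psi mulrC ler_wpM2r ?phi_ge0 ?modulus_mono ?v_max.
- apply: integrableZl; [exact: leb_measurable_itv|exact: phi_int].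
Qed.

(** Phrasing the conclusion with an upper bound [V] of [v] rather than with the
    supremum of [v] lets the statement also supply the boundedness of [v]. *)
Lemma bihari_inequality (t : R) : 0 < a ->
  (forall s, 0 <= s <= T ->
     ((v s)%:E <= a%:E + \int[leb R]_(r in `[0%R, s]) (psi r)%:E)%E) ->
  0 <= t <= T ->
  exists2 V, forall s, 0 <= s <= t -> v s <= V &
    (\int[leb R]_(U in `[a, V]) ((theta U)^-1)%:E <=
     \int[leb R]_(s in `[0%R, t]) (phi s)%:E)%E.
Proof.
move=> a0 v_le /andP[t0 tT]; have T0 := le_trans t0 tT.
have psi_int := integrable_kernel T0.
pose Phi s := \int[leb R]_(r in `[0, s]) phi r.
pose V s := a + \int[leb R]_(r in `[0, s]) psi r.
have sub_int (f : R -> R) s :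
    (leb R).-integrable `[0, T] (EFin \o f) -> s <= T ->
    (\int[leb R]_(r in `[0%R, s]) f r)%:E =
    (\int[leb R]_(r in `[0%R, s]) (f r)%:E)%E.
  move=> fi sT; rewrite fineK//.
  apply: integrable_fin_num; first exact: leb_measurable_itv.
  exact: integrable_sub_itv fi.
have Phi_sub r s : 0 <= r -> r <= s -> s <= t ->
    Phi s - Phi r = \int[leb R]_(x in `]r, s]) phi x.
  move=> r0 rs st; have sT := le_trans st tT.
  by rewrite /Phi (Rintegral_leb_itvD r0 rs sT phi_int) addrC addKr.
have V_sub r s : 0 <= r -> r <= s -> s <= t ->
    V s - V r = \int[leb R]_(x in `]r, s]) psi x.
  move=> r0 rs st; have sT := le_trans st tT.
  rewrite /V opprD addrACA subrr add0r.
  by rewrite (Rintegral_leb_itvD r0 rs sT psi_int) addrC addKr.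
have V_nd r s : 0 <= r -> r <= s -> s <= t -> V r <= V s.
  move=> r0 rs st; rewrite -subr_ge0 V_sub//; apply: Rintegral_ge0 => x /=.
  rewrite in_itv/= => /andP[rx xs]; apply: kernel_ge0.
  by rewrite (le_trans r0 (ltW rx)) (le_trans xs (le_trans st tT)).
have vV s : 0 <= s -> s <= t -> v s <= V s.
  move=> s0 st; have sT := le_trans st tT.
  by rewrite -lee_fin EFinD sub_int//; apply: v_le; rewrite s0.
have V0 : V 0 = a.
  by rewrite /V Rintegral_leb_itv1 addr0.
have V_gt0 s : 0 <= s -> s <= t -> 0 < V s.
  by move=> s0 st; apply: lt_le_trans a0 _; rewrite -V0 V_nd.
exists (V t).
  by move=> s /andP[s0 st]; apply: le_trans (vV _ s0 st) _; exact: V_nd.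
rewrite -[in leLHS]V0 -sub_int//.
apply: (@osgood_comparison _ theta theta_gt0 theta_incr t V Phi) => //.
- by rewrite V0.
- exact: Rintegral_leb_itv1.
- move=> r s r0 rs st; rewrite V_sub// Phi_sub//.
  have sT := le_trans st tT.
  rewrite -RintegralZl; first last.
  + exact: integrable_sub_itv phi_int.
  + exact: leb_measurable_itv.
  apply: le_Rintegral; first exact: leb_measurable_itv.
  + exact: integrable_sub_itv psi_int.
  + have phi_rs : (leb R).-integrable `]r, s] (EFin \o phi).
      exact: integrable_sub_itv phi_int.
    exact: (integrableZl (leb_measurable_itv _) (theta (V s)) phi_rs).
  move=> x /=; rewrite in_itv/= => /andP[rx xs].
  have x0 := le_trans r0 (ltW rx); have xt := le_trans xs st.
  rewrite /psi mulrC ler_wpM2r ?phi_ge0 ?x0 ?(le_trans xt)// modulus_mono//.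
  by apply: le_trans (vV _ x0 xt) _; exact: V_nd.
- move=> e e0; have [d d0 Hd] := Rintegral_abs_continuous phi_int phi_ge0 e0.
  exists d => // r s r0 rs st rsd; rewrite Phi_sub//.
  by apply: Hd => //; exact: le_trans tT.
Qed.

End bihari.

(** * Mild solutions *)

Section mild_solutions.
Context {R : realType} {X : completeNormedModType R}.
Variables (T : R) (A : X -> set X) (S : R -> X -> X) (F : R -> X -> X).
Variables (phi theta : R -> R) (u0 u0' : X) (u u' : R -> X).
Hypothesis T_gt0 : 0 < T.
Hypothesis A_maccr : m_accretive A.
Hypothesis S_gen : generated_semigroup A S.
Hypothesis theta_gt0 : forall U : R, 0 < U -> 0 < theta U.
Hypothesis theta_incr : forall U V : R, 0 < U -> U <= V -> theta U <= theta V.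
Hypothesis theta_0 : theta 0 = 0.
Hypothesis phi_int : (leb R).-integrable `[0, T] (EFin \o phi).
Hypothesis phi_ge0 : forall t : R, 0 <= t <= T -> 0 <= phi t.
Hypothesis F_phitheta : {ae leb R, forall t, t \in `]0, T[ ->
     forall x y : X, `|F t x - F t y| <= phi t * theta `|x - y|}.
Hypothesis u_fix : mild_fixed_point S F T u0 u.
Hypothesis u'_fix : mild_fixed_point S F T u0' u'.

Let v t := `|u t - u' t|.

Lemma mild_dist_continuous : {within `[0, T], continuous v}.
Proof.
move=> t; apply: cvg_norm; apply: cvgB; [exact: u_fix.1|exact: u'_fix.1].
Qed.

Let v_ge0 (t : R) : 0 <= v t. Proof. exact: normr_ge0. Qed.

Let bound t := (`|u0 - u0'|%:E +
  \int[leb R]_(s in `[0%R, t]) (phi s * theta (v s))%:E)%E.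

Let mkernel (t : R) : t <= T ->
  measurable_fun (`[0, t]%classic : set lebesgueType)
    (fun s : lebesgueType => (phi s * theta (v s))%:E : \bar R).
Proof.
move=> tT; apply/measurable_EFinP.
apply: measurable_funS (measurable_kernel theta_gt0 theta_incr theta_0 phi_int
  v_ge0 mild_dist_continuous).
  exact: leb_measurable_itv.
by apply: subset_itvl; rewrite bnd_simp.
Qed.

Let kernel0 (s : R) : 0 <= s <= T -> (0 <= (phi s * theta (v s))%:E)%E.
Proof.
by move=> sT; rewrite lee_fin mulr_ge0 ?phi_ge0 ?(modulus_ge0 theta_gt0).
Qed.

Lemma mild_dist_lt (t : R) : 0 <= t < T -> ((v t)%:E <= bound t)%E.
Proof.
move=> tT; have [iu uE] := u_fix.2 t tT; have [iu' u'E] := u'_fix.2 t tT.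
have /andP[t0 tT'] := tT.
rewrite /v uE u'E /mild_map opprD addrACA.
apply: le_trans (_ : _ <= (`|S t u0 - S t u0'|)%:E +
  (`|bochner_integral (leb R) `[0, t] (mild_integrand S F u t) -
     bochner_integral (leb R) `[0, t] (mild_integrand S F u' t)|)%:E)%E _.
  by rewrite -EFinD lee_fin ler_normD.
apply: leeD.
  by rewrite lee_fin; exact: semigroup_nonexpansive A_maccr S_gen t0.
apply: bochner_integral_dist => //.
- exact: completed_lebesgue_measure_is_complete.
- exact: leb_measurable_itv.
- by apply: mkernel; exact: ltW.
- move=> s /=; rewrite in_itv/= => /andP[s0 st]; apply: kernel0.
  by rewrite s0 (le_trans st (ltW tT')).
(* The bound on [F] is assumed on an open interval, whence the removal of 0. *)
have ae0 : {ae leb R, forall s, s != 0}.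
  exists [set 0]; split; last by move=> s /= /negP; rewrite negbK => /eqP.
    by apply: leb_measurable; exact: measurable_set1.
  exact: leb_set1.
have aeF : Filter (nbhs (almost_everywhere (leb R))).
  exact: ae_filter_ringOfSetsType.
apply: filterS2 F_phitheta ae0 => s Fs s0 /=; rewrite in_itv/= => /andP[s0' st].
rewrite lee_fin /mild_integrand.
apply: le_trans (Fs _ _ _); last first.
  by rewrite in_itv/= lt_neqAle eq_sym s0 s0' (le_lt_trans st).
by apply: semigroup_nonexpansive A_maccr S_gen _; rewrite subr_ge0.
Qed.

(** The fixed-point equations say nothing at [T] itself. If the bound failed
    there, the continuous function [v] would already take a value above
    [bound T] at an earlier time, where [v <= bound <= bound T]. *)
Lemma mild_dist_le (t : R) : 0 <= t <= T -> ((v t)%:E <= bound t)%E.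
Proof.
move=> /andP[t0]; rewrite le_eqVlt => /predU1P[->|tT]; last first.
  by apply: mild_dist_lt; rewrite t0.
have bound_le s : 0 <= s < T -> ((v s)%:E <= bound T)%E.
  move=> sT; apply: le_trans (mild_dist_lt sT) _; have /andP[s0 sT'] := sT.
  apply: leeD2l; apply: ge0_subset_integral; try exact: leb_measurable_itv.
  - exact: mkernel.
  - by move=> r /=; rewrite in_itv/= => rT; exact: kernel0.
  - by apply: subset_itvl; rewrite bnd_simp ltW.
rewrite leNgt; apply/negP => Bv.
case: (bound T) bound_le Bv => [B| |] bound_le;
    rewrite ?ltNge ?leey//; last first.
  by have := bound_le 0; rewrite lexx T_gt0 => /(_ isT).
rewrite -ltNge lte_fin => Bv.
have v0 : v 0 <= B by rewrite -lee_fin bound_le// lexx.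
have mid : Num.min (v 0) (v T) <= (B + v T) / 2 <= Num.max (v 0) (v T).
  by rewrite ge_min le_max; apply/andP; split; apply/orP; [left|right]; lra.
have [c] := IVT (ltW T_gt0) mild_dist_continuous mid.
rewrite in_itv/= => /andP[c0]; rewrite le_eqVlt => /predU1P[->|cT] vc.
  by lra.
by have := bound_le c; rewrite c0 cT lee_fin vc => /(_ isT); lra.
Qed.

Hypothesis theta_cont : forall U : R, 0 < U -> {for U, continuous theta}.

Lemma mild_dist_bihari (a t : R) : 0 < a -> `|u0 - u0'| <= a -> 0 <= t <= T ->
  exists2 V, forall s, 0 <= s <= t -> v s <= V &
    (\int[leb R]_(U in `[a, V]) ((theta U)^-1)%:E <=
     \int[leb R]_(s in `[0%R, t]) (phi s)%:E)%E.
Proof.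
move=> a0 ua; apply: bihari_inequality theta_gt0 theta_incr theta_cont theta_0
  phi_int phi_ge0 v_ge0 mild_dist_continuous t a0 _ => s sT.
by apply: le_trans (mild_dist_le sT) _; exact: leeD2r.
Qed.

Lemma sup_norm_ge0 (t : R) : 0 <= t <= T -> 0 <= sup_norm t (u \- u').
Proof.
move=> tT; have /andP[t0 _] := tT.
have [||V vV _] := mild_dist_bihari (a := `|u0 - u0'| + 1) _ _ tT.
- by rewrite ltr_wpDl.
- by rewrite lerDl.
apply: le_trans (v_ge0 0) _; apply: ub_le_sup.
  by exists V => _ /= [s sI <-]; apply: vV; move: sI; rewrite in_itv.
by exists 0; rewrite //= in_itv/= lexx.
Qed.

Lemma sup_norm_osgood (a t : R) : 0 < a -> `|u0 - u0'| <= a -> 0 <= t <= T ->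
  (\int[leb R]_(U in `[a, sup_norm t (u \- u')%R]) ((theta U)^-1)%:E <=
   \int[leb R]_(s in `[0%R, t]) (phi s)%:E)%E.
Proof.
move=> a0 ua tT; have [V vV WV] := mild_dist_bihari a0 ua tT.
apply: le_trans WV; apply: osgood_integral_mono => //.
apply: sup_le_ub.
  by exists (v 0), 0 => //=; rewrite in_itv/= lexx; case/andP: tT.
by move=> _ /= [s sI <-]; apply: vV; move: sI; rewrite in_itv.
Qed.

(** With equal initial data, [sup_norm_osgood] applies to every lower limit
    [a > 0], and monotone convergence as [a] tends to 0 bounds the integral of
    [1 / theta] near 0 by that of [phi]. *)
Lemma osgood_uniqueness (t : R) : osgood theta -> `|u0 - u0'| = 0 ->
  0 <= t <= T -> sup_norm t (u \- u') = 0.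
Proof.
move=> theta_osgood uu t0T; have /andP[t0 tT] := t0T.
apply/eqP; rewrite eq_le sup_norm_ge0// andbT leNgt; apply/negP => M0.
have [e [[e0 eM] We]] : exists e : R, (0 < e /\ e < sup_norm t (u \- u')) /\
    (\int[leb R]_(U in `]0%R, e]) ((theta U)^-1)%:E = +oo)%E.
  apply: (@filter_ex _ (0^'+)); apply: filterI theta_osgood; apply: filterI.
    exact: nbhs_right_gt.
  exact: nbhs_right_lt.
pose D n := `[n.+1%:R^-1, e]%classic : set R.
have DU : \bigcup_n D n = `]0, e]%classic.
  apply/seteqP; split=> [x [n _] | x] /=; rewrite /D/= !in_itv/=.
    by move=> /andP[nx ->]; rewrite andbT (lt_le_trans _ nx).
  move=> /andP[x0 xe]; exists (Num.truncn x^-1) => //=.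
  rewrite in_itv/= xe andbT -[leRHS]invrK lef_pV2 ?posrE ?invr_gt0//.
  by apply: ltW; exact: truncnS_gt.
have n0 n : 0 < n.+1%:R^-1 :> R by rewrite invr_gt0.
have D_nd : nondecreasing_seq D.
  move=> m n mn; apply/subsetPset => x; rewrite /D/= !in_itv/= => /andP[mx ->].
  by rewrite andbT (le_trans _ mx)// lef_pV2 ?posrE// ler_nat.
have := @ge0_nondecreasing_set_cvg_integral _ lebesgueType R D
  (fun U => ((theta U)^-1)%:E) (leb R) D_nd (fun n => leb_measurable_itv _)
  (fun n => measurable_inv_modulus theta_gt0 theta_incr (n0 n))
  (fun n U => inv_modulus_ge0 theta_gt0 (n0 n)).
rewrite DU We => cvW.
have Phi_fin : (\int[leb R]_(s in `[0%R, t]) (phi s)%:E)%E \is a fin_num.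
  apply: integrable_fin_num; first exact: leb_measurable_itv.
  exact: integrable_sub_itv phi_int.
suff : (+oo <= \int[leb R]_(s in `[0%R, t]) (phi s)%:E)%E.
  by rewrite leye_eq => /eqP Phi_oo; rewrite Phi_oo in Phi_fin.
apply: (lee_cvg_to cvW (cvg_cst _)); apply: nearW => n.
apply: le_trans (sup_norm_osgood (n0 n) _ t0T); last by rewrite uu ltW.
exact: (osgood_integral_mono theta_gt0 theta_incr (n0 n) (ltW eM)).
Qed.

End mild_solutions.
Theorem corollary2 (R : realType) (X : completeNormedModType R) (T : R)
  (A : X -> set X) (S : R -> X -> X) (F : R -> X -> X)
  (phi theta : R -> R) (u0 u0' : X) (u u' : R -> X)
  (T_gt0 : 0 < T)
  (A_maccr : m_accretive A)
  (A_dense : closure (op_domain A) = setT)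
  (S_gen : generated_semigroup A S)
  (F_int : forall x : X, bochner_integrable (leb R) `[0, T] (F ^~ x))
  (theta_gt0 : forall U : R, 0 < U -> 0 < theta U)
  (theta_cont : forall U : R, 0 < U -> {for U, continuous theta})
  (theta_incr : forall U V : R, 0 < U -> U <= V -> theta U <= theta V)
  (theta_0p : theta x @[x --> 0^'+] --> 0)
  (theta_0 : theta 0 = 0)
  (phi_int : (leb R).-integrable `[0, T] (EFin \o phi))
  (phi_ge0 : forall t : R, 0 <= t <= T -> 0 <= phi t)
  (F_phitheta : {ae leb R, forall t, t \in `]0, T[ ->
     forall x y : X, `|F t x - F t y| <= phi t * theta `|x - y|})
  (u_fix : mild_fixed_point S F T u0 u)
  (u'_fix : mild_fixed_point S F T u0' u') :
  (0 < `|u0 - u0'| ->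
     forall t : R, 0 <= t <= T ->
       (\int[leb R]_(s in `[`|u0 - u0'|%R, sup_norm t (u \- u')%R])
           ((theta s)^-1)%:E
        <= \int[leb R]_(s in `[0%R, t]) (phi s)%:E)%E) /\
  (osgood theta ->
     `|u0 - u0'| = 0 ->
     forall t : R, 0 <= t <= T -> sup_norm t (u \- u') = 0).
Proof.
split=> [uu0 t tT | theta_osgood uu t tT].
- exact: (sup_norm_osgood T_gt0 A_maccr S_gen theta_gt0 theta_incr theta_0
    phi_int phi_ge0 F_phitheta u_fix u'_fix theta_cont uu0 (lexx _) tT).
- exact: (osgood_uniqueness T_gt0 A_maccr S_gen theta_gt0 theta_incr theta_0
    phi_int phi_ge0 F_phitheta u_fix u'_fix theta_cont theta_osgood uu tT).
Qed.
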